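(* Let $X=(X_n)_{n\in\mathbb{Z}}$ be an i.i.d. sequence of random variables with values in $\{-1,0,1,2,\dots\}$ with $0<\mathbb{P}[X_0=-1]\le1$ and $\mathbb{E}[X_0]=0$. Let $\pi$ be the distribution of $X_0+1$. Let $[\mathbf{T},0]$ be the connected component of $0$ in the record graph of $X$, rooted at $0$ and viewed as an ordered Family Tree in which children are ordered by the order of $\mathbb{Z}$. Then $[\mathbf{T},0]$ has the distribution of the ordered Eternal Galton-Watson Tree $EGWT(\pi)$.
   Context: For a sequence $x=(x_n)_{n\in\mathbb{Z}}$ write $y(j,k)=\sum_{l=j}^{k-1}x_l$ for $j<k$. The record map is $R_x(i)=\inf\{n>i: y(i,n)\ge0\}$ if this set is nonempty, and $R_x(i)=i$ otherwise. The record graph has vertex set $\mathbb{Z}$ and a directed edge $i\to R_x(i)$ (child to parent) whenever $R_x(i)\ne i$; components are taken in the undirected sense. A Family Tree is a directed tree in which every vertex has out-degree at most one; it is an Eternal Family Tree (EFT) if every vertex has out-degree exactly one. $F$ denotes the parent map and $F^0(\mathbf{o})=\mathbf{o}$. For a distribution $\pi$ on $\{0,1,2,\dots\}$ with mean $1$ and $\pi(1)<1$, with size-biased distribution $\hat\pi(k)=k\pi(k)$, $EGWT(\pi)$ is the random rooted ordered EFT $[\mathbf{T},\mathbf{o}]$ in which: the root and all its descendants reproduce independently with offspring distribution $\pi$; for each $n\ge1$ the ancestor $F^n(\mathbf{o})$ has a $\hat\pi$-distributed number of children (one of which is $F^{n-1}(\mathbf{o})$); the descendants of $F^n(\mathbf{o})$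 that are not descendants of $F^{n-1}(\mathbf{o})$ (and not $F^{n-1}(\mathbf{o})$) reproduce independently with distribution $\pi$; all reproductions are independent; and the order among the children of every vertex is uniform. *)

(* Defs.v *)
From HB Require Import structures.
From mathcomp Require Import all_boot all_order all_algebra.
From mathcomp Require Import all_classical all_reals all_analysis.
Set Implicit Arguments. Unset Strict Implicit. Unset Printing Implicit Defensive.
Import Order.TTheory GRing.Theory Num.Theory.
Local Open Scope classical_set_scope.
Local Open Scope ring_scope.

Inductive ptree := PNode of seq ptree.
Definition pleaf := PNode [::].
Definition pkids (t : ptree) : seq ptree := let: PNode ts := t in ts.

Section Record.
Variable R : realType.

Definition ysum (x : int -> R) (j k : int) : R :=
  \sum_(l < `|k - j|%N) x (j + l%:Z).

(* [is_rec x i n] : n = R_x(i) = inf {n > i : y(i,n) >= 0} and this set is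
   nonempty (i.e. there is an edge i -> n in the record graph, n <> i).      *)
Definition is_rec (x : int -> R) (i n : int) : Prop :=
  i < n /\ 0 <= ysum x i n /\ (forall m, i < m -> m < n -> ysum x i m < 0).

Definition rchild (x : int -> R) (c v : int) : Prop := is_rec x c v.

(* [rmatch x v d t] : the ordered tree of descendants of v (children ordered by
   the order of Z), truncated at depth d (vertices at depth d are shown as
   leaves), is the plane tree t. *)
Fixpoint rmatch (x : int -> R) (v : int) (d : nat) (t : ptree) : Prop :=
  match d with
  | 0%N => t = pleaf
  | d'.+1 =>
      exists cs : seq int,
        [/\ sorted <%R cs,
            (forall c, c \in cs <-> rchild x c v),
            size cs = size (pkids t) &
            (forall j, (j < size cs)%N ->
               rmatch x (nth 0 cs j) d' (nth pleaf (pkids t) j))]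
  end.

(* [rmarks x v a w] : following the path a (a list of 0-based child indices,
   children ordered by the order of Z) downwards from v leads to w. *)
Fixpoint rmarks (x : int -> R) (v : int) (a : seq nat) (w : int) : Prop :=
  match a with
  | [::] => w = v
  | i :: a' =>
      exists c : int, rchild x c v /\
        (exists cs : seq int, [/\ uniq cs,
            (forall e, e \in cs <-> (rchild x e v /\ e < c)) & size cs = i]) /\
        rmarks x c a' w
  end.

(* Cylinder event of the rooted ordered family tree [T,0] (component of 0 in the
   record graph): the ancestor u = F^n(0) exists, the truncation at depth n+h of
   the ordered tree of descendants of u is t, and 0 sits at address a in it. *)
Definition record_cyl (x : int -> R) (n h : nat) (t : ptree) (a : seq nat) : Prop :=
  exists u : int, rmatch x u (n + h) t /\ rmarks x u a 0.

(* Probability, under EGWT(pi), that the (depth d)-truncation of the descendants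
   of F^n(o) is t with o at address a (size a = n).  Each vertex on the path
   strictly above o has a size-biased number k of children (prob. k * pi k) and
   the position of the child on the path is uniform (prob. 1/k); every other
   vertex (o, its descendants and the descendants of the other children of the
   ancestors) reproduces independently according to pi. *)
Fixpoint egwt_weight (pi : nat -> R) (d : nat) (t : ptree) (a : seq nat) : R :=
  match d with
  | 0%N => match t, a with PNode [::], [::] => 1 | _, _ => 0 end
  | d'.+1 =>
      let ts := pkids t in
      let k := size ts in
      match a with
      | [::] => pi k * \prod_(j < k) egwt_weight pi d' (nth pleaf ts j) [::]
      | i :: a' =>
          if (i < k)%N then
            (k%:R * pi k) * (k%:R)^-1 *
            \prod_(j < k) egwt_weight pi d' (nth pleaf ts j)
                            (if (j == i :> nat) then a' else [::])
          else 0
      end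
  end.

Definition egwt_cyl (pi : nat -> R) (n h : nat) (t : ptree) (a : seq nat) : R :=
  egwt_weight pi (n + h) t a.

End Record.

Definition iid_seq {d} {T : measurableType d} {R : realType}
  (P : probability T R) (X : int -> T -> R) : Prop :=
  (forall (S : seq int) (B : int -> set R), uniq S ->
     (forall i, measurable (B i)) ->
     P (\bigcap_(i in [set` S]) (X i @^-1` B i)) =
     (\prod_(i <- S) P (X i @^-1` B i))%E) /\
  (forall (n : int) (B : set R), measurable B ->
     P (X n @^-1` B) = P (X 0 @^-1` B)).

Definition law_plus1 {d} {T : measurableType d} {R : realType}
  (P : probability T R) (X0 : T -> R) (k : nat) : R :=
  fine (P (X0 @^-1` [set k%:R - 1])).

(* Main.v *)
Require Import Defs.
From HB Require Import structures.
From mathcomp Require Import all_boot all_order all_algebra.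
From mathcomp Require Import all_classical all_reals all_analysis.
From mathcomp Require Import measurable_realfun zify ring lra.
Import Order.TTheory GRing.Theory Num.Theory.
Local Open Scope classical_set_scope.
Local Open Scope ring_scope.

Set Implicit Arguments.
Unset Strict Implicit.
Unset Printing Implicit Defensive.

(* Read backwards from a vertex [v], the sequence [X + 1] spells the Lukasiewicz
   word of the tree of descendants of [v], as soon as that tree is finite.  Hence
   this tree is the finite tree [s] with probability the product of [pi] over the
   letters of the word of [s].  The total mass [z] of these probabilities is a
   fixed point of the generating function of [pi], and [z = 1] because [pi] is
   critical and [pi 0 > 0].  So every vertex has almost surely a finite
   Galton-Watson tree of descendants.  Finally, if [v] has tree [s], then [0] sits
   at address [a] below [v] exactly when [v] is the offset of [a] in the word of
   [s]; summing over [v] removes this constraint (mass transport), and what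
   remains is the Galton-Watson weight of [s].  This is the weight in the eternal tree, since the
   factor [k] of size-biasing cancels the uniform choice [1 / k] of the position. *)

(** * Plane trees: induction, countability and truncation *)

(** The generated principle gives no hypothesis for trees nested in a list. Children are indexed by
    [nth] to match [rmatch] and [egwt_weight]. *)
Lemma ptree_nth_ind (Q : ptree -> Prop) :
  (forall ts, (forall j, (j < size ts)%N -> Q (nth pleaf ts j)) -> Q (PNode ts)) ->
  forall t, Q t.
Proof.
move=> IH; fix rec 1; case=> ts; apply: IH.
elim: ts => [j|t ts IHts [_|j jts]]; [move=> j0; discriminate j0 | exact: rec | exact: IHts].
Qed.

(** Countability of trees is what permits measurable unions indexed by them. *)
Fixpoint ptree_encode (t : ptree) : GenTree.tree unit :=
  let: PNode ts := t in GenTree.Node 0 (map ptree_encode ts).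

Fixpoint ptree_decode (t : GenTree.tree unit) : ptree :=
  match t with
  | GenTree.Leaf _ => pleaf
  | GenTree.Node _ ts => PNode (map ptree_decode ts)
  end.

Lemma ptree_encodeK : cancel ptree_encode ptree_decode.
Proof.
elim/ptree_nth_ind => ts IH /=; congr PNode.
rewrite -map_comp; apply: (@eq_from_nth _ pleaf); rewrite size_map // => j jts.
by rewrite (nth_map pleaf) //= IH.
Qed.

HB.instance Definition _ := Countable.copy ptree (can_type ptree_encodeK).

Fixpoint trunc (d : nat) (t : ptree) : ptree :=
  if d is d'.+1 then PNode (map (trunc d') (pkids t)) else pleaf.

Lemma trunc_inj t t' : (forall d, trunc d t = trunc d t') -> t = t'.
Proof.
elim/ptree_nth_ind: t t' => ts IH [ts'] E; congr PNode.
have Ed d : map (trunc d) ts = map (trunc d) ts' by have [] := E d.+1.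
have sz : size ts = size ts' by have := congr1 size (Ed 0%N); rewrite !size_map.
apply: (@eq_from_nth _ pleaf) => // j jts; apply: IH => // d.
by have := congr1 (nth pleaf ^~ j) (Ed d); rewrite !(nth_map pleaf) -?sz.
Qed.

(** * Lukasiewicz words of trees and forests *)

(* The Lukasiewicz word of [t], listing the children from right to left: this is
   the order in which a tree is met when exploring the sequence backwards. *)
Fixpoint code (t : ptree) : seq nat :=
  let: PNode ts := t in size ts :: flatten (rev (map code ts)).

Definition fcode (ts : seq ptree) : seq nat := flatten (rev (map code ts)).

Lemma fcode_cat ts ts' : fcode (ts ++ ts') = fcode ts' ++ fcode ts.
Proof. by rewrite /fcode map_cat rev_cat flatten_cat. Qed.

Lemma fcode_cons t ts : fcode (t :: ts) = fcode ts ++ code t.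
Proof. by rewrite -cat1s fcode_cat /fcode /= cats0. Qed.

(* [lukasiewicz k c]: the walk started at [k] with increments [i - 1] for [i] in
   [c] reaches [0] at its last step and no sooner. *)
Definition lukasiewicz (k : nat) (c : seq nat) : Prop :=
  (sumn c + k = size c)%N /\
  (forall m, (m < size c)%N -> (m < sumn (take m c) + k)%N).

(** The first word brings the walk from [k + k'] down to [k'], staying above [k'] until its last
    step; the second then brings it to [0]. *)
Lemma lukasiewicz_cat k c k' c' :
  lukasiewicz k c -> lukasiewicz k' c' -> lukasiewicz (k + k') (c ++ c').
Proof.
move=> [E1 L1] [E2 L2]; split=> [|m]; rewrite ?sumn_cat size_cat; first lia.
move=> mlt; rewrite take_cat; case: (ltnP m (size c)) => mc; first by have := L1 _ mc; lia.
by rewrite sumn_cat; have := L2 (m - size c)%N; lia.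
Qed.

(** The claim is assumed for the children because this serves in the induction of
    [lukasiewicz_code], where the first letter takes the walk from [1] to the number of children. *)
Lemma lukasiewicz_fcode_of ts :
  (forall j, (j < size ts)%N -> lukasiewicz 1 (code (nth pleaf ts j))) ->
  lukasiewicz (size ts) (fcode ts).
Proof.
elim: ts => [|t ts IH] H //=.
rewrite fcode_cons -addn1; apply: lukasiewicz_cat; last exact: (H 0%N).
by apply: IH => j jts; exact: (H j.+1).
Qed.

Lemma lukasiewicz_code t : lukasiewicz 1 (code t).
Proof.
elim/ptree_nth_ind: t => ts /lukasiewicz_fcode_of [E L].
split=> [|[|m]] //=; rewrite -/(fcode ts); first lia.
by rewrite ltnS => /L; lia.
Qed.

Lemma lukasiewicz_fcode ts : lukasiewicz (size ts) (fcode ts).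
Proof. by apply: lukasiewicz_fcode_of => j _; exact: lukasiewicz_code. Qed.

Lemma size_code_gt0 t : (0 < size (code t))%N.
Proof. by case: t. Qed.

(** * Children in the record graph, read off a block *)

Section Deterministic.
Variable R : realType.
Implicit Types (x : int -> R) (v w : int) (s t : ptree) (ts : seq ptree).

(** Letters start at [v - 1] and go left: an edge into [v] depends only on entries to the left of
    [v]. *)
Definition block x v (c : seq nat) : Prop :=
  forall j, (j < size c)%N -> x (v - 1 - j%:Z) = (nth 0%N c j)%:R - 1.

Lemma block_cat x v c1 c2 :
  block x v (c1 ++ c2) <-> block x v c1 /\ block x (v - (size c1)%:Z) c2.
Proof.
split=> [B | [B1 B2] j].
  split=> j jc.
    by have := B j; rewrite nth_cat jc size_cat; apply; lia.
  have := B (size c1 + j)%N; rewrite nth_cat size_cat ifF; last lia.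
  rewrite addKn => /(_ ltac:(lia)) <-; congr x; lia.
rewrite size_cat nth_cat => jc; case: ltnP => j1; first exact: B1.
rewrite -B2; last lia.
congr x; lia.
Qed.

Lemma ysum_split x (i m v : int) : i <= m -> m <= v ->
  ysum x i v = ysum x i m + ysum x m v.
Proof.
move=> im mv; rewrite /ysum.
have -> : absz (v - i) = (absz (m - i) + absz (v - m))%N by lia.
rewrite big_split_ord /=; congr (_ + _).
apply: eq_bigr => l _; congr x; lia.
Qed.

Lemma ysum_block x v c m : block x v c -> (m <= size c)%N ->
  ysum x (v - m%:Z) v = (sumn (take m c))%:R - m%:R.
Proof.
move=> B; elim: m => [|m IH] mc.
  by rewrite take0 /ysum subr0 subrr /= big_ord0 subr0.
rewrite (@ysum_split _ _ (v - m%:Z)); [|lia|lia].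
rewrite IH; last lia.
have -> : ysum x (v - (m.+1)%:Z) (v - m%:Z) = x (v - 1 - m%:Z).
  rewrite /ysum (_ : absz _ = 1%N); last lia.
  rewrite big_ord1 /=; congr x; lia.
rewrite B // (take_nth 0%N) // sumn_rcons natrD -[m.+1]addn1 natrD; ring.
Qed.

(* In a block coding [PNode ts] just before [v], the [j]-th child of [v]. *)
Definition kid v ts j : int := v - 1 - (size (fcode (drop j.+1 ts)))%:Z.

Lemma kid_lt v ts j : (j.+1 < size ts)%N -> kid v ts j < kid v ts j.+1.
Proof.
move=> jts; rewrite /kid [in X in X < _](drop_nth pleaf) // fcode_cons size_cat.
have := size_code_gt0 (nth pleaf ts j.+1); lia.
Qed.

Lemma fcode_split ts j : (j < size ts)%N ->
  fcode ts = fcode (drop j.+1 ts) ++ code (nth pleaf ts j) ++ fcode (take j ts).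
Proof.
move=> jts; rewrite -{1}(cat_take_drop j ts) (drop_nth pleaf) //.
by rewrite fcode_cat fcode_cons catA.
Qed.

Lemma block_kid x v ts j : block x v (code (PNode ts)) -> (j < size ts)%N ->
  block x (kid v ts j) (code (nth pleaf ts j)).
Proof.
move=> + jts; rewrite /= -/(fcode ts) -cat1s => /block_cat[_].
by rewrite (fcode_split jts) => /block_cat[_] /block_cat[].
Qed.

Lemma ysum_node x v ts m : block x v (code (PNode ts)) ->
  (m <= size (fcode ts))%N ->
  ysum x (v - (m.+1)%:Z) v =
    (size ts)%:R - 1 + (sumn (take m (fcode ts)))%:R - m%:R.
Proof.
move=> B mts; rewrite (ysum_block B) //=.
rewrite natrD -[m.+1]addn1 natrD -/(fcode ts); ring.
Qed.

(** The first letter contributes [size ts - 1]; the forest of the [size ts - j.+1] later siblings,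
    being a Lukasiewicz word, lowers the sum by its number of trees. *)
Lemma ysum_kid x v ts j : block x v (code (PNode ts)) -> (j < size ts)%N ->
  ysum x (kid v ts j) v = j%:R.
Proof.
move=> B jts; have [E _] := lukasiewicz_fcode (drop j.+1 ts).
rewrite size_drop in E.
have -> : kid v ts j = v - (size (fcode (drop j.+1 ts))).+1%:Z by rewrite /kid; lia.
have sz := congr1 size (fcode_split jts); rewrite !size_cat in sz.
rewrite (ysum_node B) //; last lia.
rewrite (fcode_split jts) take_size_cat // -E.
have -> : (size ts)%:R = (size ts - j.+1)%:R + j%:R + 1 :> R.
  by rewrite -natrD natr1 -addn1; congr _%:R; lia.
rewrite natrD; ring.
Qed.

(** The walk over the later siblings is positive until it ends. Hence, going left from [v], the sum
    first comes down to [j] at [kid v ts j]. *)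
Lemma ysum_gt_kid x v ts j (c : int) : block x v (code (PNode ts)) -> (j < size ts)%N ->
  kid v ts j < c -> c < v -> j%:R < ysum x c v.
Proof.
move=> B jts kc cv; have [E L] := lukasiewicz_fcode (drop j.+1 ts).
rewrite size_drop in E L.
have [m mE] : exists m : nat, c = v - m.+1%:Z.
  by exists (absz (v - c)).-1; lia.
have sz := congr1 size (fcode_split jts); rewrite !size_cat in sz.
have mlt : (m < size (fcode (drop j.+1 ts)))%N by move: kc; rewrite /kid; lia.
rewrite mE (ysum_node B) //; last lia.
rewrite (fcode_split jts) takel_cat; last lia.
have := L m mlt; set q := sumn _ => Lm.
have : (j + m + 1 < q + size ts)%N by lia.
rewrite -(ltr_nat R) !natrD /=; lra.
Qed.

(** Children of [v] are the places where the sums met going left from [v] reach a nonnegative strict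
    minimum. Each level [j] below [size ts] is first reached at [kid v ts j]. *)
Lemma rchild_kid x v ts (c : int) : block x v (code (PNode ts)) ->
  rchild x c v <-> exists2 j, (j < size ts)%N & c = kid v ts j.
Proof.
move=> B; split=> [[cv [y0 ymin]] | [j jts ->]]; last first.
  split; first by rewrite /kid; lia.
  split; first by rewrite (ysum_kid B).
  move=> m km mv; have := ysum_gt_kid B jts km mv.
  by have := ysum_split x (ltW km) (ltW mv); rewrite (ysum_kid B) //; lra.
have {}ymin m : c < m -> m < v -> ysum x c v < ysum x m v.
  by move=> cm mv; rewrite (ysum_split x (ltW cm) (ltW mv)); have := ymin m cm mv; lra.
have [m mE] : exists m : nat, c = v - m.+1%:Z.
  by exists (absz (v - c)).-1; lia.
have [E _] := lukasiewicz_fcode ts.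
(* The whole block sums to [-1], so a nonnegative new minimum must occur strictly inside it. *)
have yend : ysum x (v - (size (fcode ts)).+1%:Z) v = -1.
  rewrite (ysum_node B) // take_size -E natrD; ring.
have mle : (m < size (fcode ts))%N.
  rewrite ltnNge; apply/negP; rewrite leq_eqVlt => /orP[/eqP mE'|mlt].
    by move: y0; rewrite mE -mE' yend; lra.
  by have := ymin (v - (size (fcode ts)).+1%:Z) ltac:(lia) ltac:(lia); lra.
have yc := ysum_node B (ltnW mle); rewrite -mE in yc.
have y1 : ysum x c v <= (size ts)%:R - 1.
  have y1 : ysum x (v - 1) v = (size ts)%:R - 1.
    by have := ysum_node B (leq0n _); rewrite take0 /= => ->; ring.
  have [->|c1] := eqVneq c (v - 1); first by rewrite y1.
  by rewrite -y1 ltW // ymin //; lia.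
set q := sumn (take m (fcode ts)) in yc.
have mq : (m.+1 <= q + size ts)%N.
  by rewrite -(ler_nat R) natrD -addn1 natrD /=; lra.
have qm : (q <= m)%N by rewrite -(ler_nat R); lra.
(* The level of the sum at [c]: [mq] makes the truncated subtraction exact and [qm] keeps it below
   [size ts]. *)
pose j := (q + size ts - m.+1)%N.
have yj : ysum x c v = j%:R.
  by rewrite yc /j natrB // natrD -addn1 natrD /=; ring.
have jts : (j < size ts)%N by rewrite /j; lia.
exists j => //; case: (ltgtP c (kid v ts j)) => // ck.
  have kv : kid v ts j < v by rewrite /kid; lia.
  by have := ymin _ ck kv; rewrite (ysum_kid B jts) yj ltxx.
by have := ysum_gt_kid B jts ck cv; rewrite yj ltxx.
Qed.

Lemma sorted_kids v ts m : (m <= size ts)%N ->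
  sorted <%R [seq kid v ts j | j <- iota 0 m].
Proof.
move=> mts; apply/(sortedP 0) => j; rewrite size_map size_iota => jm.
rewrite !(nth_map 0%N) ?size_iota ?nth_iota ?add0n ?(ltnW jm) //.
exact/kid_lt/(leq_trans jm).
Qed.

Lemma ltr_kid v ts j k : (j < size ts)%N -> (k < size ts)%N ->
  (kid v ts j < kid v ts k) = (j < k)%N.
Proof.
move=> jts kts; have st := sorted_kids v (leqnn (size ts)).
have nthE l : (l < size ts)%N ->
    nth 0 [seq kid v ts j | j <- iota 0 (size ts)] l = kid v ts l.
  by move=> lts; rewrite (nth_map 0%N) ?size_iota // nth_iota.
by rewrite -!nthE // lt_sorted_ltn_nth // inE size_map size_iota.
Qed.

(** A strictly increasing list is determined by its members, so the list in [rmatch] must be that of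
    the kids, each preceded by the block of its own subtree. *)
Lemma rmatch_block x v d s t : block x v (code s) ->
  rmatch x v d t <-> t = trunc d s.
Proof.
elim: d v s t => [|d IH] v [ts] t B //=.
have memL c : c \in [seq kid v ts j | j <- iota 0 (size ts)] <-> rchild x c v.
  rewrite (rchild_kid _ B); split=> [/mapP[j]|[j jts ->]].
    by rewrite mem_iota => /andP[_ jts] ->; exists j.
  by apply: map_f; rewrite mem_iota.
split=> [[cs [scs memcs szcs H]] | ->].
  have csE : cs = [seq kid v ts j | j <- iota 0 (size ts)].
    apply: lt_sorted_eq => //; first exact: sorted_kids.
    by move=> c; apply/idP/idP => [/memcs/memL|/memL/memcs].
  case: t szcs H => us /= szcs H; congr PNode.
  have sz : size cs = size ts by rewrite csE size_map size_iota.
  apply: (@eq_from_nth _ pleaf); first by rewrite size_map -szcs.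
  rewrite -szcs => j jcs; have jts : (j < size ts)%N by rewrite -sz.
  have := H j jcs; rewrite (nth_map pleaf) // csE (nth_map 0%N) ?size_iota //.
  by rewrite nth_iota // add0n => /(IH _ _ _ (block_kid B jts)).
exists [seq kid v ts j | j <- iota 0 (size ts)]; split=> //=.
- exact: sorted_kids.
- by rewrite !size_map size_iota.
- move=> j; rewrite size_map size_iota => jts.
  rewrite !(nth_map 0%N) ?size_iota // nth_iota // add0n (nth_map pleaf) //.
  exact/(IH _ _ _ (block_kid B jts)).
Qed.

End Deterministic.

(** * Addresses and marked descendants *)

Fixpoint valid (a : seq nat) (t : ptree) : bool :=
  if a is i :: a' then (i < size (pkids t))%N && valid a' (nth pleaf (pkids t) i)
  else true.

(* Position, in the Lukasiewicz word [code t], of the vertex of [t] at address [a]. *)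
Fixpoint offset (a : seq nat) (t : ptree) : nat :=
  if a is i :: a' then
    ((size (fcode (drop i.+1 (pkids t)))).+1 + offset a' (nth pleaf (pkids t) i))%N
  else 0%N.

Lemma valid_trunc d a t : (size a <= d)%N -> valid a (trunc d t) = valid a t.
Proof.
elim: d a t => [|d IH] [|i a] t //= ad.
by rewrite size_map; case: ltnP => // it; rewrite (nth_map pleaf) // IH.
Qed.

Section Marks.
Variable R : realType.
Implicit Types (x : int -> R) (v w : int).

Lemma rmarks_block x v a w s : block x v (code s) ->
  rmarks x v a w <-> valid a s /\ w = v - (offset a s)%:Z.
Proof.
elim: a v s => [|i a IH] v [ts] B /=; first by rewrite subr0; split=> [->|[]].
(* The siblings to the left of kid [j] are exactly the [j] kids of smaller index, so the index read
   by [rmarks] is [j]. *)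
have csP j (cs : seq int) : (j < size ts)%N -> uniq cs ->
    (forall e, e \in cs <-> (rchild x e v /\ e < kid v ts j)) -> size cs = j.
  move=> jts ucs memcs.
  have -> : j = size [seq kid v ts l | l <- iota 0 j] by rewrite size_map size_iota.
  apply/perm_size/uniq_perm => //; first exact/lt_sorted_uniq/sorted_kids/ltnW.
  move=> e; apply/idP/mapP.
    move=> /memcs[/(rchild_kid _ B)[l lts ->]].
    by rewrite ltr_kid // => lj; exists l => //; rewrite mem_iota.
  move=> [l]; rewrite mem_iota add0n => /andP[_ lj] ->; apply/memcs.
  have lts := ltn_trans lj jts; rewrite ltr_kid //; split=> //.
  by apply/(rchild_kid _ B); exists l.
split.
  move=> [c [/(rchild_kid _ B)[j jts ->] [[cs [ucs memcs <-]]]]].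
  rewrite (csP j) // => /(IH _ _ (block_kid B jts))[-> ->]; rewrite jts; split=> //.
  by rewrite /kid; lia.
move=> [/andP[its va] wE]; exists (kid v ts i); split.
  by apply/(rchild_kid _ B); exists i.
have memE e : e \in [seq kid v ts l | l <- iota 0 i] <-> (rchild x e v /\ e < kid v ts i).
  split.
    move=> /mapP[l]; rewrite mem_iota add0n => /andP[_ lj] ->.
    have lts := ltn_trans lj its; rewrite ltr_kid //; split=> //.
    by apply/(rchild_kid _ B); exists l.
  move=> [/(rchild_kid _ B)[l lts ->]].
  by rewrite ltr_kid // => li; apply: map_f; rewrite mem_iota.
have ui : uniq [seq kid v ts l | l <- iota 0 i] by exact/lt_sorted_uniq/sorted_kids/ltnW.
split; first by exists [seq kid v ts l | l <- iota 0 i]; split=> //; exact: csP.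
apply/(IH _ _ (block_kid B its)); split=> //.
by rewrite wE /kid; lia.
Qed.

(** The truncations of both trees are those of the descendant tree of [v] in the record graph. *)
Lemma block_inj x v s s' : block x v (code s) -> block x v (code s') -> s = s'.
Proof.
move=> B B'; apply: trunc_inj => d.
exact/(rmatch_block _ _ B')/(rmatch_block _ _ B).
Qed.

Lemma is_rec_fun x i n n' : is_rec x i n -> is_rec x i n' -> n = n'.
Proof.
move=> [i1 [y1 m1]] [i2 [y2 m2]]; case: (ltgtP n n') => // nn'.
  by have := m2 n i1 nn'; rewrite ltNge y1.
by have := m1 n' i2 nn'; rewrite ltNge y2.
Qed.

(** Each vertex has at most one parent, so the end of a path and its address determine its start.
    This makes the events for distinct ancestors disjoint. *)
Lemma rmarks_fun x a v v' w : rmarks x v a w -> rmarks x v' a w -> v = v'.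
Proof.
elim: a v v' => [|i a IH] v v' /= => [<- //|[c [cv [_ cw]]] [c' [cv' [_ cw']]]].
by rewrite -(IH _ _ cw cw') in cv'; exact: is_rec_fun cv cv'.
Qed.

Lemma rmarks_le x a v w : rmarks x v a w -> w <= v.
Proof.
elim: a v => [|i a IH] v /= => [-> //|[c [[cv _] [_ /IH wc]]]].
exact: le_trans (ltW cv).
Qed.

End Marks.

(** * Measures and nonnegative sums over countable families *)

Lemma measure_bigcup_esum (d : measure_display) (T : measurableType d)
    (R : realType) (mu : {measure set T -> \bar R}) (I : countType) (A : set I)
    (F : I -> set T) :
  (forall i, measurable (F i)) -> trivIset A F ->
  mu (\bigcup_(i in A) F i) = (\esum_(i in A) mu (F i))%E.
Proof.
(* The index type is moved into [nat] by [pickle]; numbers that code nothing get [set0]. *)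
move=> mF tF; pose G n := if unpickle n is Some i then F i else set0.
have FG i : F i = G (pickle i) by rewrite /G pickleK.
have -> : \bigcup_(i in A) F i = \bigcup_(n in pickle @` A) G n.
  by rewrite bigcup_image; apply: eq_bigcupr => i _.
rewrite measure_bigcup.
- rewrite nneseries_esum // set_mem_set esum_image; last first.
    by move=> i j _ _; exact: (pcan_inj (@pickleK I)).
  by apply: eq_esum => i _; rewrite -FG.
- by move=> _ [i _ <-]; rewrite -FG.
- move=> _ _ [i Ai <-] [j Aj <-]; rewrite -!FG => ne.
  by congr pickle; exact: tF ne.
Qed.

Lemma ge0_esumZl (R : realType) (I : choiceType) (A : set I) (f : I -> \bar R)
    (c : R) : (forall i, (0 <= f i)%E) -> 0 <= c ->
  (\esum_(i in A) (c%:E * f i) = c%:E * \esum_(i in A) f i)%E.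
Proof.
move=> f0 c0; rewrite /esum -ereal_supZl //; last first.
  by apply/set0P; exists (\sum_(i \in set0) f i)%E; exists set0; [exact: fsets_set0|].
congr ereal_sup; rewrite image_comp; apply: eq_imagel => X _ /=.
by rewrite ge0_mule_fsumr.
Qed.

Section SeqsIn.
Variables (R : realType) (T : choiceType) (w : T -> R).
Hypothesis w_ge0 : forall s, 0 <= w s.
Hypothesis w_fin : forall A, (\esum_(s in A) (w s)%:E)%E \is a fin_num.

Definition mass (A : set T) : R := fine (\esum_(s in A) (w s)%:E)%E.

Lemma massE A : (\esum_(s in A) (w s)%:E)%E = (mass A)%:E.
Proof. by rewrite /mass fineK. Qed.

Lemma mass_ge0 A : 0 <= mass A.
Proof. by apply: fine_ge0; apply: esum_ge0 => s _; rewrite lee_fin. Qed.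

Fixpoint seqs_in (B : seq (set T)) : set (seq T) :=
  if B is A :: B' then (fun p => p.1 :: p.2) @` (A `*` seqs_in B')
  else [set [::]].

Lemma seqs_inP x0 B ts : seqs_in B ts <->
  size ts = size B /\ forall j, (j < size B)%N -> nth set0 B j (nth x0 ts j).
Proof.
elim: B ts => [|A B IH] ts /=.
  by split=> [->//|[/size0nil]].
split=> [[[t us] /= [At /IH[sz H]] <-] /=|[]].
  by rewrite sz; split=> // -[|j] //=; exact: H.
case: ts => //= t us [sz] H; exists (t, us) => //; split; first exact: (H 0%N).
by apply/IH; split=> // j; exact: (H j.+1).
Qed.

(** Nonnegative sums distribute over products; this expresses the independence of the subtrees of
    siblings. *)
Lemma esum_seqs_in B :
  (\esum_(ts in seqs_in B) (\prod_(t <- ts) w t)%:E)%E = (\prod_(A <- B) mass A)%:E.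
Proof.
elim: B => [|A B IH] /=.
  by rewrite esum_set1 !big_nil // lee_fin.
rewrite esum_image; last by move=> [t ts] [t' ts'] _ _ /= [-> ->].
have prod_ge0 (ts : seq T) : 0 <= \prod_(t <- ts) w t by exact: prodr_ge0.
rewrite (_ : A `*` seqs_in B = A `*`` (fun=> seqs_in B)) //.
under eq_esum do rewrite big_cons.
rewrite -(esum_esum (a := fun t ts => (w t * \prod_(u <- ts) w u)%:E)); last first.
  by move=> t ts _ _; rewrite lee_fin mulr_ge0.
rewrite big_cons mulrC EFinM -(massE A) -ge0_esumZl //; last first.
  by apply: prodr_ge0 => A' _; exact: mass_ge0.
apply: eq_esum => t _; under eq_esum do rewrite EFinM.
by rewrite ge0_esumZl ?IH // muleC.
Qed.

End SeqsIn.

(** * Total mass and truncations of Galton-Watson trees *)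

Section GaltonWatson.
Variables (R : realType) (pi : nat -> R).
Hypothesis pi_ge0 : forall k, 0 <= pi k.

(* Probability that the full Galton-Watson tree is [t]. *)
Definition gw (t : ptree) : R := \prod_(k <- code t) pi k.

Lemma gw_ge0 t : 0 <= gw t.
Proof. exact: prodr_ge0. Qed.

Lemma gw_node ts : gw (PNode ts) = pi (size ts) * \prod_(t <- ts) gw t.
Proof.
rewrite /gw /= big_cons; congr (_ * _); rewrite -/(fcode ts).
by elim: ts => [|t ts IH]; rewrite ?big_nil // fcode_cons big_cat big_cons /= IH mulrC.
Qed.

Hypothesis gw_fin : forall A, (\esum_(t in A) (gw t)%:E)%E \is a fin_num.

Lemma esum_gw_node B :
  (\esum_(t in PNode @` seqs_in B) (gw t)%:E)%E =
  (pi (size B) * \prod_(A <- B) mass gw A)%:E.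
Proof.
rewrite esum_image; last by move=> ts ts' _ _ [].
transitivity (\esum_(ts in seqs_in B) ((pi (size B))%:E * (\prod_(t <- ts) gw t)%:E))%E.
  by apply: eq_esum => ts /(seqs_inP pleaf)[<- _]; rewrite gw_node.
rewrite ge0_esumZl //; first by rewrite esum_seqs_in //; exact: gw_ge0.
by move=> ts; rewrite lee_fin prodr_ge0 // => t _; exact: gw_ge0.
Qed.

(** Splitting by the number of children of the root shows that the mass of the finite trees, the
    extinction probability, is fixed by the generating function. *)
Lemma mass_gw_fixpoint :
  (\sum_(0 <= k <oo) (pi k * mass gw setT ^+ k)%:E)%E = (mass gw setT)%:E.
Proof.
pose J k : set ptree := PNode @` seqs_in (nseq k setT).
rewrite -massE // [in RHS](_ : setT = \bigcup_(k in setT) J k); last first.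
  apply/esym/seteqP; split=> // -[ts] _; exists (size ts) => //; exists ts => //.
  by apply/(seqs_inP pleaf); rewrite size_nseq; split=> // j jts; rewrite nth_nseq jts.
rewrite esum_bigcupT; first last.
- by move=> t; rewrite lee_fin gw_ge0.
- move=> j k _ _ [_ [[ts /(seqs_inP pleaf)[+ _] <-] [ts' /(seqs_inP pleaf)[+ _] [e]]]].
  by rewrite e !size_nseq => <- <-.
rewrite nneseries_esumT; last first.
  by move=> k; rewrite lee_fin mulr_ge0 // exprn_ge0 // mass_ge0 //; exact: gw_ge0.
apply: eq_esum => k _; rewrite esum_gw_node size_nseq big_nseq.
by rewrite iter_mulr_1.
Qed.

(* Convexity of the generating function, in a form that gives uniqueness of its
   fixed point after averaging over an offspring law of mean [1]. *)
Lemma expr_tangent_gap (z : R) (k : nat) : 0 <= z -> z <= 1 ->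
  1 + k%:R * (1 - z) ^+ 2 + (k == 0%N)%:R * (1 - z) ^+ 2
    <= z ^+ k + k%:R * (1 - z) + (1 - z) ^+ 2.
Proof.
move=> z0 z1; case: k => [|k] /=; first by rewrite expr0 !mul0r mul1r; lra.
elim: k => [|k IH]; first by rewrite !mul1r expr1 mul0r; lra.
have zk : z ^+ k.+1 <= z by rewrite exprS ler_piMr // exprn_ile1.
(* This product is the growth of the right side minus that of the left from [k.+1] to [k.+2]. *)
have : 0 <= (1 - z) * (z - z ^+ k.+1) by apply: mulr_ge0; lra.
move: IH; rewrite !mul0r [z ^+ k.+2]exprS -[k.+2]addn1 natrD /=.
set y := z ^+ k.+1; set q := k.+1%:R; nra.
Qed.

Hypothesis pi_sum : (\sum_(0 <= k <oo) (pi k)%:E)%E = 1%E.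
Hypothesis pi_mean : (\sum_(0 <= k <oo) (k%:R * pi k)%:E)%E = 1%E.
Hypothesis pi0_gt0 : 0 < pi 0.
Hypothesis mass_le1 : mass gw setT <= 1.

Lemma mass_gw_setT : mass gw setT = 1.
Proof.
have := mass_gw_fixpoint; have := mass_le1; set z := mass gw setT => z1 fix_z.
have z0 : 0 <= z by apply: mass_ge0; exact: gw_ge0.
pose u := 1 - z; have u0 : 0 <= u by rewrite /u; lra.
have ge0_pi k : (0 <= (pi k)%:E)%E by rewrite lee_fin.
have ge0_kpi k : (0 <= (k%:R * pi k)%:E)%E by rewrite lee_fin mulr_ge0.
have ge0_zpi k : (0 <= (pi k * z ^+ k)%:E)%E by rewrite lee_fin mulr_ge0 // exprn_ge0.
pose e k : \bar R := ((k == 0%N)%:R * pi k)%:E.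
have ge0_e k : (0 <= e k)%E by rewrite lee_fin mulr_ge0.
have sum_e : (\sum_(0 <= k <oo) e k)%E = (pi 0)%:E.
  rewrite (nneseries_split 0%N 1%N) ?big_nat1 //= eseries0 ?adde0 /e ?mul1r //.
  by move=> k k1 _; rewrite (_ : (k == 0)%N = false) ?mul0r //; lia.
(* The tangent inequality is multiplied by [pi k] and summed. All terms are nonnegative, so both
   series can be split. *)
have : (\sum_(0 <= k <oo) ((pi k)%:E + ((u ^+ 2)%:E * (k%:R * pi k)%:E + (u ^+ 2)%:E * e k))
   <= \sum_(0 <= k <oo) ((pi k * z ^+ k)%:E +
        (u%:E * (k%:R * pi k)%:E + (u ^+ 2)%:E * (pi k)%:E)))%E.
  apply: lee_nneseries => k _.
    by rewrite !adde_ge0 // mule_ge0 // lee_fin exprn_ge0.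
  rewrite /e -!EFinM -!EFinD lee_fin.
  have := ler_wpM2l (pi_ge0 k) (expr_tangent_gap k z0 z1); rewrite -/u.
  set b := (k == 0%N)%:R; set y := z ^+ k; set q := k%:R; nra.
have u2 : 0 <= u ^+ 2 by exact: exprn_ge0.
rewrite !nneseriesD //; try by move=> k _ _; rewrite ?adde_ge0 // mule_ge0 // lee_fin.
rewrite !nneseriesZl // pi_sum pi_mean fix_z sum_e -!EFinM -!EFinD lee_fin => H.
(* [H] reads [1 + (u ^+ 2 + u ^+ 2 * pi 0) <= z + (u + u ^+ 2)], and [z + u = 1]. *)
have : u ^+ 2 * pi 0 <= 0 by move: H; rewrite /u; lra.
rewrite pmulr_lle0 // => u20; have : u == 0 by rewrite -sqrf_eq0 eq_le u20.
by move/eqP; rewrite /u; lra.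
Qed.

Lemma mass_gw_trunc d t :
  mass gw [set s | trunc d s = t] = egwt_weight pi d t [::].
Proof.
elim: d t => [|d IH] [us] /=.
  case: us => [|u us].
    (* At depth [0] every tree truncates to a leaf, so total mass [1] enters here. *)
    by rewrite -[RHS]mass_gw_setT; congr mass; apply/seteqP; split.
  rewrite (_ : [set _ | _] = set0); first by rewrite /mass esum_set0.
  by apply/seteqP; split.
pose B := [seq [set s | trunc d s = u] | u <- us].
have -> : [set s | trunc d.+1 s = PNode us] = PNode @` seqs_in B.
  apply/seteqP; split=> [[ts] /= [tsE]|_ [ts /(seqs_inP pleaf)[sz H] <-] /=].
    exists ts => //; apply/(seqs_inP pleaf); rewrite /B -tsE !size_map.
    split=> // j jts; rewrite -map_comp (nth_map pleaf) //.
  rewrite size_map in sz H; congr PNode.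
  apply: (@eq_from_nth _ pleaf); rewrite size_map sz // => j jus.
  by have := H j jus; rewrite /B (nth_map pleaf set0) //= => <-; rewrite (nth_map pleaf) ?sz.
rewrite /mass esum_gw_node /= size_map big_map (big_nth pleaf) big_mkord.
by congr (_ * _); apply: eq_bigr => j _; rewrite IH.
Qed.

Lemma egwt_weight_marked d t a : (size a <= d)%N ->
  egwt_weight pi d t a = if valid a t then egwt_weight pi d t [::] else 0.
Proof.
elim: d t a => [|d IH] t [|i a] //= ad; case: ltnP => // it.
have k0 : (size (pkids t))%:R != 0 :> R by rewrite pnatr_eq0 -lt0n (leq_ltn_trans _ it).
rewrite [_%:R * _]mulrC mulfK // /=.
(* An invalid tail [a] puts a factor [0] at child [i] only; pulling these factors out leaves the
   unmarked product. *)
have -> : \prod_(j < size (pkids t)) egwt_weight pi d (nth pleaf (pkids t) j)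
    (if j == i :> nat then a else [::]) =
  \prod_(j < size (pkids t)) ((if (j == i :> nat) && ~~ valid a (nth pleaf (pkids t) i)
     then 0 else 1) * egwt_weight pi d (nth pleaf (pkids t) j) [::]).
  apply: eq_bigr => j _; case: eqP => [->|_] /=; last by rewrite mul1r.
  by rewrite IH //; case: valid => /=; rewrite ?mul1r ?mul0r.
rewrite big_split /=; case: valid => /=.
  by rewrite big1 ?mul1r // => j _; rewrite andbF.
by rewrite (bigD1 (Ordinal it)) //= eqxx !mul0r mulr0.
Qed.

End GaltonWatson.

(** * Measurability of events defined by countable quantifiers *)

Section MeasurablePredicates.
Variables (d : measure_display) (T : measurableType d).
Implicit Types p q : T -> Prop.

Lemma measurable_const_pred (b : Prop) : measurable [set _ : T | b].
Proof.
have [bT|bF] := pselect b.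
  by rewrite (_ : [set _ | _] = setT) //; apply/seteqP; split.
by rewrite (_ : [set _ | _] = set0) //; apply/seteqP; split.
Qed.

Lemma measurable_and_pred p q : measurable [set w | p w] ->
  measurable [set w | q w] -> measurable [set w | p w /\ q w].
Proof. by move=> mp mq; exact: (measurableI _ _ mp mq). Qed.

Lemma measurable_not_pred p : measurable [set w | p w] ->
  measurable [set w | ~ p w].
Proof. exact: measurableC. Qed.

Lemma measurable_exists_pred (I : countType) (p : I -> T -> Prop) :
  (forall i, measurable [set w | p i w]) -> measurable [set w | exists i, p i w].
Proof.
move=> mp; rewrite (_ : [set _ | _] = \bigcup_i [set w | p i w]).
  by apply: countable_bigcupT_measurable => //; exact: countableP.
by apply/seteqP; split=> w [i]; [exists i | exists i].
Qed.

Lemma measurable_forall_pred (I : countType) (p : I -> T -> Prop) :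
  (forall i, measurable [set w | p i w]) -> measurable [set w | forall i, p i w].
Proof.
move=> mp; rewrite (_ : [set _ | _] = [set w | ~ exists i, ~ p i w]).
  apply: measurable_not_pred; apply: measurable_exists_pred => i.
  exact: measurable_not_pred.
by apply/seteqP; split=> w /= => [h [i []]|/forallNP h i]; [exact: h | exact: contrapT (h i)].
Qed.

Lemma measurable_imply_pred (b : Prop) q : (b -> measurable [set w | q w]) ->
  measurable [set w | b -> q w].
Proof.
move=> mq; have [bT|bF] := pselect b.
  rewrite (_ : [set _ | _] = [set w | q w]); first exact: mq.
  by apply/seteqP; split=> w //=; apply.
by rewrite (_ : [set _ | _] = setT) //; apply/seteqP; split=> // w _ /bF.
Qed.

Lemma measurable_iff_pred p q : measurable [set w | p w] ->
  measurable [set w | q w] -> measurable [set w | p w <-> q w].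
Proof.
move=> mp mq; rewrite (_ : [set _ | _] =
    ([set w | p w] `&` [set w | q w]) `|` (~` [set w | p w] `&` ~` [set w | q w])).
  by apply: measurableU; apply: measurableI => //; exact: measurableC.
apply/seteqP; split=> w /=; last by tauto.
by have [] := pselect (p w); tauto.
Qed.

End MeasurablePredicates.

Section RecordMeasurability.
Variables (d : measure_display) (T : measurableType d) (R : realType).
Variable X : int -> T -> R.
Hypothesis mX : forall n, measurable_fun setT (X n).

Lemma measurable_is_rec i n : measurable [set w | is_rec (X^~ w) i n].
Proof.
have my j k : measurable_fun setT (fun w => ysum (X^~ w) j k).
  by apply: measurable_sum => l; exact: mX.
have ge0 j k : measurable [set w | 0 <= ysum (X^~ w) j k].
  rewrite -[[set _ | _]]setTI.
  have := my j k measurableT _ (measurable_itv `[0, +oo[%R).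
  by congr (measurable (_ `&` _)); apply/seteqP; split=> w /=; rewrite in_itv /= andbT.
apply: measurable_and_pred; first exact: measurable_const_pred.
apply: measurable_and_pred; first exact: ge0.
apply: measurable_forall_pred => m.
apply: measurable_imply_pred => _; apply: measurable_imply_pred => _.
rewrite (_ : [set _ | _] = ~` [set w | 0 <= ysum (X^~ w) i m]).
  exact: measurableC.
by apply/seteqP; split=> w /=; rewrite ltNge => /negP.
Qed.

Lemma measurable_rmatch v e t : measurable [set w | rmatch (X^~ w) v e t].
Proof.
elim: e v t => [|e IH] v t /=; first exact: measurable_const_pred.
apply: measurable_exists_pred => cs.
rewrite (_ : [set _ | _] = [set w | sorted <%R cs /\
    ((forall c, c \in cs <-> rchild (X^~ w) c v) /\ (size cs = size (pkids t) /\
     (forall j, (j < size cs)%N ->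
        rmatch (X^~ w) (nth 0 cs j) e (nth pleaf (pkids t) j))))]); last first.
  by apply/seteqP; split=> w /= => [[]|[? [? []]]].
apply: measurable_and_pred; first exact: measurable_const_pred.
apply: measurable_and_pred.
  apply: measurable_forall_pred => c; apply: measurable_iff_pred.
    exact: measurable_const_pred.
  exact: measurable_is_rec.
apply: measurable_and_pred; first exact: measurable_const_pred.
apply: measurable_forall_pred => j; apply: measurable_imply_pred => _.
exact: IH.
Qed.

Lemma measurable_rmarks v a u : measurable [set w | rmarks (X^~ w) v a u].
Proof.
elim: a v => [|i a IH] v /=; first exact: measurable_const_pred.
apply: measurable_exists_pred => c.
apply: measurable_and_pred; first exact: measurable_is_rec.
apply: measurable_and_pred; last exact: IH.
apply: measurable_exists_pred => cs.
rewrite (_ : [set _ | _] = [set w | uniq cs /\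
    ((forall e, e \in cs <-> (rchild (X^~ w) e v /\ e < c)) /\ size cs = i)]); last first.
  by apply/seteqP; split=> w /= => [[]|[? []]].
apply: measurable_and_pred; first exact: measurable_const_pred.
apply: measurable_and_pred; last exact: measurable_const_pred.
apply: measurable_forall_pred => e; apply: measurable_iff_pred.
  exact: measurable_const_pred.
by apply: measurable_and_pred; [exact: measurable_is_rec | exact: measurable_const_pred].
Qed.

End RecordMeasurability.

(** * Law of the descendant tree of a vertex *)

Section RecordProbability.
Variables (R : realType) (d : measure_display) (T : measurableType d).
Variables (P : probability T R) (X : int -> T -> R).
Hypothesis mX : forall n, measurable_fun setT (X n).
Hypothesis hiid : iid_seq P X.

Let pi := law_plus1 P (X 0).

Lemma measurable_fiber n (r : R) : measurable (X n @^-1` [set r]).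
Proof. by rewrite -[_ @^-1` _]setTI; exact: mX. Qed.

Lemma probability_fiber n (k : nat) : P (X n @^-1` [set k%:R - 1]) = (pi k)%:E.
Proof.
rewrite hiid.2 // /pi /law_plus1 fineK // fin_num_measure //.
exact: measurable_fiber.
Qed.

Lemma law_plus1_ge0 k : 0 <= pi k.
Proof. by rewrite -lee_fin -(probability_fiber 0) measure_ge0. Qed.

(** This is the form required by [iid_seq], where one set is attached to every integer: the letter
    index is recovered from the position [i]. *)
Lemma block_eventE v c : [set w | block (X^~ w) v c] =
  \bigcap_(i in [set` [seq v - 1 - j%:Z | j <- iota 0 (size c)]])
     (X i @^-1` [set (nth 0%N c (absz (v - 1 - i)%R))%:R - 1]).
Proof.
apply/seteqP; split=> w /= H.
  move=> _ /= /mapP[j + ->]; rewrite mem_iota add0n => /andP[_ jc].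
  by rewrite H //; congr ((nth _ _ _)%:R - 1); lia.
move=> j jc; have jS : v - 1 - j%:Z \in [seq v - 1 - j%:Z | j <- iota 0 (size c)].
  by apply: map_f; rewrite mem_iota.
have /= -> := H _ jS; congr ((nth _ _ _)%:R - 1); lia.
Qed.

Lemma measurable_block v c : measurable [set w | block (X^~ w) v c].
Proof.
apply: measurable_forall_pred => j; apply: measurable_imply_pred => _.
exact: measurable_fiber.
Qed.

(** The value does not depend on [v]; the final sum over ancestors rests on this invariance. *)
Lemma probability_block v c :
  P [set w | block (X^~ w) v c] = (\prod_(k <- c) pi k)%:E.
Proof.
rewrite block_eventE (hiid.1 _ (fun i => [set (nth 0%N c (absz (v - 1 - i)%R))%:R - 1])) //.
- rewrite -prodEFin big_map [in RHS](big_nth 0%N) /index_iota subn0.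
  apply: eq_big_seq => j _; rewrite probability_fiber; congr (pi (nth _ _ _))%:E; lia.
- by rewrite map_inj_uniq ?iota_uniq // => j k; lia.
Qed.

Lemma trivIset_block v A : trivIset A (fun s => [set w | block (X^~ w) v (code s)]).
Proof. by move=> s s' _ _ [w [B B']]; exact: block_inj B B'. Qed.

Lemma probability_bigcup_block v A :
  P (\bigcup_(s in A) [set w | block (X^~ w) v (code s)]) =
  (\esum_(s in A) (gw pi s)%:E)%E.
Proof.
rewrite measure_bigcup_esum; last exact: trivIset_block.
  by apply: eq_esum => s _; exact: probability_block.
by move=> s; exact: measurable_block.
Qed.

Lemma measurable_bigcup_block v A :
  measurable (\bigcup_(s in A) [set w | block (X^~ w) v (code s)]).
Proof.
rewrite bigcup_mkcond; apply: countable_bigcupT_measurable => [|s].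
  exact: countableP.
by case: ifP => // _; exact: measurable_block.
Qed.

(** The weights are probabilities of disjoint events at vertex [0]. This gives finiteness and the
    bound on the total mass that [mass_gw_setT] assumes. *)
Lemma gw_esum_le1 A : (\esum_(s in A) (gw pi s)%:E <= 1)%E.
Proof.
rewrite -(probability_bigcup_block 0); apply: probability_le1.
exact: measurable_bigcup_block.
Qed.

Lemma gw_esum_fin A : (\esum_(s in A) (gw pi s)%:E)%E \is a fin_num.
Proof.
rewrite ge0_fin_numE; first exact: le_lt_trans (gw_esum_le1 A) (ltry _).
by apply: esum_ge0 => s _; rewrite lee_fin gw_ge0 //; exact: law_plus1_ge0.
Qed.

Hypothesis hval : forall n w, exists k : nat, X n w = k%:R - 1.
Hypothesis hneg : (0 < P (X 0%R @^-1` [set (-1)%R]))%E.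
Hypothesis hmean : ('E_P[X 0%R] = 0)%E.

Lemma law_plus1_0_gt0 : 0 < pi 0.
Proof. by move: hneg; rewrite -lte_fin -(probability_fiber 0) sub0r. Qed.

Lemma bigcup_fiber : \bigcup_k (X 0 @^-1` [set k%:R - 1]) = setT.
Proof. by apply/seteqP; split=> // w _; have [k Xk] := hval 0 w; exists k. Qed.

Lemma trivIset_fiber : trivIset setT (fun k : nat => X 0 @^-1` [set k%:R - 1]).
Proof.
move=> j k _ _ [w [/= -> /eqP]].
by rewrite (inj_eq (addIr _)) eqr_nat => /eqP.
Qed.

Lemma law_plus1_sum : (\sum_(0 <= k <oo) (pi k)%:E)%E = 1%E.
Proof.
rewrite -(@probability_setT _ _ _ P) -bigcup_fiber measure_semi_bigcup.
- by apply: eq_eseriesr => k _; exact: (esym (probability_fiber 0 k)).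
- by move=> k; exact: measurable_fiber.
- exact: trivIset_fiber.
- by rewrite bigcup_fiber.
Qed.

(** The negative part of [X 0] is at most [1], so its integral is finite, and mean [0] makes it
    equal to that of the positive part. *)
Lemma integral_add1 : (\int[P]_w (X 0 w + 1)%:E = 1)%E.
Proof.
have X_ge w : -1 <= X 0 w by have [k ->] := hval 0 w; rewrite lerDr.
pose f (w : T) : \bar R := (X 0 w)%:E.
have mf : measurable_fun setT f by exact/measurable_EFinP.
have neg_le w : (f^\- w <= 1)%E.
  by rewrite funenegE /f ge_max lee01 andbT -EFinN lee_fin; have := X_ge w; lra.
have int1 : (\int[P]_w (cst 1 w) = 1)%E.
  by rewrite integral_cst // mul1e; exact: probability_setT.
have fin_neg : (\int[P]_w f^\- w)%E \is a fin_num.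
  rewrite ge0_fin_numE; last by apply: integral_ge0 => w _.
  apply: (@le_lt_trans _ _ (\int[P]_w (cst 1 w))%E); last first.
    by rewrite int1 ltry.
  by apply: ge0_le_integral => //; exact/measurable_funeneg.
have pos_neg : (\int[P]_w f^\+ w = \int[P]_w f^\- w)%E.
  have := hmean; rewrite unlock integralE -/f.
  move: fin_neg; case: (\int[P]_w f^\- w)%E => // b _.
  have : (0 <= \int[P]_w f^\+ w)%E by apply: integral_ge0 => w _.
  case: (\int[P]_w f^\+ w)%E => // r _ [] /eqP.
  by rewrite subr_eq0 => /eqP ->.
(* Both sides are sums of nonnegative functions, so they integrate termwise and the equal finite
   integrals cancel. *)
have : (\int[P]_w ((X 0 w + 1)%:E + f^\- w) = \int[P]_w (f^\+ w + (cst 1 w)))%E.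
  apply: eq_integral => w _.
  rewrite funeposE funenegE /f /= -!EFin_max. rewrite -!EFinD; congr EFin.
  have [X0|X0] := leP (X 0 w) 0.
    by rewrite max_l ?oppr_ge0 //; lra.
  by rewrite max_r ?oppr_le0 ?(ltW X0) // addr0.
rewrite ge0_integralD //; last 3 first.
- by move=> w _; rewrite lee_fin; have := X_ge w; lra.
- by apply/measurable_EFinP; exact: measurable_funD.
- exact: measurable_funeneg.
rewrite ge0_integralD //; last exact: measurable_funepos.
rewrite int1 pos_neg addeC.
move: fin_neg; case: (\int[P]_w f^\- w)%E => // b _.
by case: (\int[P]_w _)%E => // r [] /addrI ->.
Qed.

Lemma law_plus1_mean : (\sum_(0 <= k <oo) (k%:R * pi k)%:E)%E = 1%E.
Proof.
rewrite -integral_add1 -bigcup_fiber ge0_integral_bigcup.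
- apply: eq_eseriesr => k _.
  rewrite (eq_integral (cst k%:R%:E)); last first.
    by move=> w; rewrite inE /= => ->; rewrite subrK.
  rewrite integral_cst; last exact: measurable_fiber.
  by rewrite EFinM -(probability_fiber 0).
- by move=> k; exact: measurable_fiber.
- rewrite bigcup_fiber; apply/measurable_EFinP; exact: measurable_funD.
- by move=> w _; rewrite lee_fin; have [k ->] := hval 0 w; rewrite subrK.
- exact: trivIset_fiber.
Qed.

Lemma probability_finite_tree v :
  P (\bigcup_s [set w | block (X^~ w) v (code s)]) = 1%E.
Proof.
rewrite probability_bigcup_block massE; last exact: gw_esum_fin.
rewrite mass_gw_setT //.
- exact: law_plus1_ge0.
- exact: gw_esum_fin.
- exact: law_plus1_sum.
- exact: law_plus1_mean.
- exact: law_plus1_0_gt0.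
- by rewrite -lee_fin -massE ?gw_esum_le1 //; exact: gw_esum_fin.
Qed.

(** Up to a null set the descendant tree of [v] is coded by a block; on that event [rmatch] and
    [rmarks] become conditions on the coded tree [s]. *)
Lemma probability_marked v e t a :
  P [set w | rmatch (X^~ w) v e t /\ rmarks (X^~ w) v a 0] =
  (\esum_(s in [set s | [/\ trunc e s = t, valid a s & v = (offset a s)%:Z]])
     (gw pi s)%:E)%E.
Proof.
set E := [set w | _]; set A := [set s | _].
have mE : measurable E.
  by apply: measurable_and_pred; [exact: measurable_rmatch | exact: measurable_rmarks].
pose O := \bigcup_s [set w | block (X^~ w) v (code s)].
have mO : measurable O by exact: measurable_bigcup_block.
have PO : P (~` O) = 0%E by rewrite probability_setC // probability_finite_tree subee.
have -> : P E = (P (E `\` O) + P (E `&` O))%E by exact: measureDI.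
rewrite (_ : P (E `\` O) = 0%E) ?add0e; last first.
  apply: subset_measure0 PO; [exact: measurableD | exact: measurableC | by move=> w []].
rewrite -(probability_bigcup_block v); congr (P _).
apply/seteqP; split=> [w [[mt ma] [s _ B]]|w [s [st va vE] B]].
  have ts := (rmatch_block _ _ B).1 mt; have [va vE] := (rmarks_block _ _ B).1 ma.
  by exists s => //; split=> //; lia.
split; last by exists s.
split; first by apply/(rmatch_block _ _ B).
by apply/(rmarks_block _ _ B); split=> //; lia.
Qed.

End RecordProbability.

(** * Mass transport over the position of the ancestor *)

Theorem theorem4p20 (R : realType) (d : measure_display) (T : measurableType d)
  (P : probability T R) (X : int -> T -> R)
  (mX : forall n, measurable_fun setT (X n))
  (hiid : iid_seq P X)
  (hval : forall n w, exists k : nat, X n w = k%:R - 1)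
  (hneg : (0 < P (X 0%R @^-1` [set (-1)%R]))%E)
  (hmean : ('E_P[X 0%R] = 0)%E) :
  forall (n h : nat) (t : ptree) (a : seq nat), size a = n ->
    P [set w | record_cyl (fun l => X l w) n h t a] =
    (egwt_cyl (law_plus1 P (X 0)) n h t a)%:E.
Proof.
move=> n h t a an; set pi := law_plus1 P (X 0).
have pi0 := law_plus1_ge0 mX hiid; have gwfin := gw_esum_fin mX hiid.
have ad : (size a <= n + h)%N by rewrite an leq_addr.
(* Natural positions suffice for the ancestor, since by [rmarks_le] no descendant lies to its
   right. *)
pose E (k : nat) :=
  [set w | rmatch (X^~ w) k (n + h) t /\ rmarks (X^~ w) k a 0].
pose A (k : nat) := [set s |
  [/\ trunc (n + h) s = t, valid a s & k%:Z = (offset a s)%:Z]].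
have mE k : measurable (E k).
  by apply: measurable_and_pred; [exact: measurable_rmatch | exact: measurable_rmarks].
have -> : [set w | record_cyl (X^~ w) n h t a] = \bigcup_k E k.
  apply/seteqP; split=> [w [u [mt ma]]|w [k _ Ek]]; last by exists k%:Z.
  have u0 := rmarks_le ma.
  by exists (absz u) => //; rewrite /E /= gez0_abs.
rewrite measure_semi_bigcup //; first last.
- exact: bigcupT_measurable.
- by move=> j k _ _ [w [[_ mj] [_ mk]]]; have [] := rmarks_fun mj mk.
(* The descendant tree of the ancestor has the same law wherever that ancestor
   sits, so summing over its position [k] only sums over the offset of [a]. *)
transitivity (\esum_(s in \bigcup_k A k) (gw pi s)%:E)%E.
  rewrite nneseries_sum_bigcup.
  - by apply: eq_eseriesr => k _; exact: probability_marked.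
  - by move=> j k _ _ [s [[_ _ ej] [_ _ ek]]]; lia.
  - by move=> s; rewrite lee_fin gw_ge0.
rewrite /egwt_cyl (egwt_weight_marked _ _ ad) massE //; congr EFin.
case: ifPn => va.
  rewrite -mass_gw_trunc //.
  (* The position is free in the union, so [k] is taken to be [offset a s]. Validity passes from [t]
     to [s] because [a] is no longer than the truncation depth. *)
  - congr mass; apply/seteqP; split=> [s [k _ []]//|s /= st].
    by exists (offset a s) => //; split=> //; rewrite -(valid_trunc s ad) st.
  - exact: law_plus1_sum.
  - exact: law_plus1_mean.
  - exact: law_plus1_0_gt0.
  - by rewrite -lee_fin -massE //; exact: gw_esum_le1.
(* An address missing from [t] is missing from every tree that truncates to [t]. *)
rewrite (_ : \bigcup_k A k = set0) ?/mass ?esum_set0 //.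
apply/seteqP; split=> // s [k _ [st vs _]].
by move: va; rewrite -st valid_trunc // vs.
Qed.
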